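(* Let $N$ nodes with utilities $U(i)$ be given and let $(p_t)_{t\ge 0}$ be real numbers with $0<Np_t<1$ for all $t$. The graph generated by Algorithm 1 with sampling probabilities $p_t$ (see context), run from any given initial graph, converges to a gradient topology with probability $1$, in the sense that almost surely $\lim_{t\to\infty}X_t^{(i)}=1$ for every node $i$, if and only if $$\lim_{T\to\infty}\sum_{t=0}^{T}p_t=\infty .$$
   Context: Nodes: $\mathcal N=\{1,\dots,N\}$; each node $i$ has a fixed utility $U(i)\in\{1,\dots,n\}$. Put $m_u=|\{i:U(i)=u\}|$ and $d(i,j)=|U(i)-U(j)|$. At each time $t=0,1,2,\dots$ each node $i$ with $U(i)=u$ has a similar view $N_i^s(t)\subseteq\mathcal N\setminus\{i\}$ with exactly $m_u$ elements (it is assumed that this is possible, i.e. $m_u\le N-1$ for all $u$ that occur as utilities). The directed graph at time $t$ has edges from $i$ to the elements of $N_i^s(t)$; the initial graph is given by the views $N_i^s(0)$, on which no further condition is imposed. Algorithm 1 with sampling probabilities $p_t$: at time $t$, each node $i$ draws a random view which equals $\{j\}$ with probability $p_t$ for each $j\in\mathcal N$ and is empty with probability $1-Np_t$; draws at different times and by different nodes are independent. If the random view is empty, or if $j=i$ or $j\in N_i^s(t)$, then $N_i^s(t+1)=N_i^s(t)$. Otherwise, if $U(j)\ge U(i)$ and $d(i,j)\le\max_{k\in N_i^s(t)}d(i,k)$, then $N_i^s(t+1)$ is obtained from $N_i^s(t)$ by adding $j$ and removing an element of $N_i^s(t)$ that maximizes $d(i,\cdot)$ over $N_i^s(t)$ (ties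 broken by any fixed deterministic rule); if these conditions fail, $N_i^s(t+1)=N_i^s(t)$. $X_t^{(i)}$ is the number of $j\in N_i^s(t)$ with $U(j)\ne U(i)$. (Since only $m_u-1$ other nodes share the utility $u=U(i)$, always $X_t^{(i)}\ge 1$. The dynamics satisfy $\mathcal P\{X_{t+1}^{(i)}=k\mid X_t^{(i)}=k+1\}=kp_t$, and otherwise $X^{(i)}$ does not change at that step.)
   Formalization: The ''only if'' direction is claimed only for initial graphs that are not already a gradient topology (some X_0^(i) ≠ 1); otherwise X stays 1 even when the sum of p_t converges, so the equivalence fails. The ''if'' direction is stated for every initial graph. *)

(* Defs.v *)
From mathcomp Require Import all_boot all_order all_algebra.
From mathcomp Require Import all_classical all_reals all_analysis.

Set Implicit Arguments.
Unset Strict Implicit.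
Unset Printing Implicit Defensive.

Import Order.TTheory GRing.Theory Num.Theory.
Import numFieldNormedType.Exports.

Local Open Scope classical_set_scope.
Local Open Scope ring_scope.

Section Dynamics.
Variables (N : nat) (U : 'I_N -> nat).

Definition mult (u : nat) : nat := #|[set i : 'I_N | U i == u]%SET|.

(* |U i - U j|, as a sum of truncated differences *)
Definition udist (i j : 'I_N) : nat := ((U i - U j) + (U j - U i))%N.

(* The similar views of all nodes; the edges go from i to the elements of V i. *)
Definition views := 'I_N -> {set 'I_N}.

Definition admissible (V : views) : Prop :=
  forall i, i \notin V i /\ #|V i| = mult (U i).

Definition maxdist (i : 'I_N) (A : {set 'I_N}) : nat :=
  (\max_(k in A) udist i k)%N.

(* [rule i A j] is the element that node i, with view A, evicts to insert j. *)
Definition eviction_rule (rule : 'I_N -> {set 'I_N} -> 'I_N -> 'I_N) : Prop :=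
  forall (i : 'I_N) (A : {set 'I_N}) (j : 'I_N), (0 < #|A|)%N ->
    rule i A j \in A /\ udist i (rule i A j) = maxdist i A.

Variable rule : 'I_N -> {set 'I_N} -> 'I_N -> 'I_N.

(* The random view is [None] when empty and [Some j] when equal to {j}. *)
Definition update (i : 'I_N) (A : {set 'I_N}) (r : option 'I_N) : {set 'I_N} :=
  if r is Some j then
    if (j == i) || (j \in A) then A
    else if (U i <= U j)%N && (udist i j <= maxdist i A)%N
    then (j |: (A :\ rule i A j))%SET
    else A
  else A.

Fixpoint run (V0 : views) (y : nat -> 'I_N -> option 'I_N) (t : nat) : views :=
  if t is s.+1 then fun i => update i (run V0 y s i) (y s i) else V0.

Definition dissimilar (V : views) (i : 'I_N) : nat :=
  #|[set j in V i | U j != U i]%SET|.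

End Dynamics.

Section Sampling.
Context {R : realType} {d : measure_display} {Omega : measurableType d}.
Variable P : probability Omega R.

(* Mutual independence of random elements of the discrete space E *)
Definition independent_family (K : choiceType) (E : Type) (Y : K -> Omega -> E)
    : Prop :=
  forall (s : seq K) (B : K -> set E), uniq s ->
    P (\bigcap_(k in [set` s]) (Y k @^-1` B k)) =
    (\prod_(k <- s) P (Y k @^-1` B k))%E.

Definition random_views (N : nat) (p : nat -> R)
    (Y : nat -> 'I_N -> Omega -> option 'I_N) : Prop :=
  [/\ forall t i (B : set (option 'I_N)), measurable (Y t i @^-1` B),
      forall t i (j : 'I_N), P (Y t i @^-1` [set Some j]) = (p t)%:E,
      forall t i, P (Y t i @^-1` [set None]) = (1 - N%:R * p t)%:E
    & independent_family (fun k : nat * 'I_N => Y k.1 k.2)].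

Definition converges_to_gradient (N : nat) (U : 'I_N -> nat)
    (rule : 'I_N -> {set 'I_N} -> 'I_N -> 'I_N) (V0 : views N)
    (Y : nat -> 'I_N -> Omega -> option 'I_N) : Prop :=
  {ae P, forall w : Omega, forall i : 'I_N,
    ((dissimilar U (run U rule V0 (fun s k => Y s k w) t) i)%:R : R)
      @[t --> \oo] --> (1 : R)}.

End Sampling.

(* Main.v *)
(* Call j a peer of i when j <> i and U j = U i. Since X^(i) >= 1, an evicted
   node always has a different utility, so a peer enters the view of i exactly
   when it is first drawn and stays there; and X^(i) = 1 iff every peer of i is
   in the view. Hence convergence amounts to every initially missing peer j
   being drawn eventually. By independence, j is never drawn with probability
   prod_t (1 - p_t), which by exp(-2 p_t) <= 1 - p_t <= exp(-p_t) is zero iff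
   sum_t p_t diverges (p_t < 1/N <= 1/2, as 1 <= m_u <= N - 1). *)

Require Import Defs.
From mathcomp Require Import all_boot all_order all_algebra.
From mathcomp Require Import all_classical all_reals all_analysis.
From mathcomp Require Import ring.

Import Order.TTheory GRing.Theory Num.Theory.
Import numFieldNormedType.Exports.

Local Open Scope classical_set_scope.
Local Open Scope ring_scope.

(** * Deterministic evolution of the views along one sequence of draws *)

Section SimilarViews.
Set Implicit Arguments.
Variables (N : nat) (U : 'I_N -> nat).
Variable rule : 'I_N -> {set 'I_N} -> 'I_N -> 'I_N.
Hypothesis hrule : eviction_rule U rule.

Definition admissible_at (i : 'I_N) (A : {set 'I_N}) : Prop :=
  i \notin A /\ #|A| = mult U (U i).

Definition peers (i : 'I_N) : {set 'I_N} :=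
  [set j | (j != i) && (U j == U i)]%SET.

Lemma card_peers i : mult U (U i) = #|peers i|.+1.
Proof.
rewrite /mult (cardsD1 i) !inE eqxx add1n; congr _.+1.
by apply: eq_card => j; rewrite !inE.
Qed.

(** Since [i] is not in its own view, the elements of [V i] that are not peers are exactly those of
    different utility; and [V i] has one element more than there are peers. *)
Lemma card_dissimilar (V : views N) i : admissible_at i (V i) ->
  (#|V i :&: peers i|%SET + dissimilar U V i = #|peers i|.+1)%N.
Proof.
move=> [iV cV]; rewrite -card_peers -cV -(cardsID (peers i) (V i)); congr addn.
apply: eq_card => j; rewrite !inE negb_and negbK.
by have [->|] := eqVneq j i; rewrite ?(negbTE iV) //= andbC.
Qed.

Lemma dissimilar_eq1 (V : views N) i : admissible_at i (V i) ->
  (dissimilar U V i == 1%N) = (peers i \subset V i).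
Proof.
move=> /card_dissimilar h.
have [_] := subset_leqif_cards (finset.subsetIr (V i) (peers i)).
rewrite (sameP eqP finset.setIidPr) => <-.
rewrite -(eqn_add2l #|V i :&: peers i|%SET) h addn1 eqSS.
by rewrite eq_sym.
Qed.

Lemma dissimilar_gt0 (V : views N) i : admissible_at i (V i) ->
  (0 < dissimilar U V i)%N.
Proof.
move=> /card_dissimilar h.
rewrite -(ltn_add2l #|V i :&: peers i|%SET) h addn0 ltnS.
by rewrite subset_leq_card ?finset.subsetIr.
Qed.

(** The peers are too few to fill the view, so some element has a different utility and lies at
    positive distance. *)
Lemma maxdist_gt0 i A : admissible_at i A -> (0 < maxdist U i A)%N.
Proof.
move=> hA; have := @dissimilar_gt0 (fun=> A) i hA.
rewrite /dissimilar => /card_gt0P [j]; rewrite inE => /andP[jA Uji].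
rewrite /maxdist (bigD1 j) //= leq_max; apply/orP; left.
by rewrite /udist addn_gt0 !subn_gt0 -neq_ltn.
Qed.

Lemma update_admissible i A r : admissible_at i A ->
  admissible_at i (update U rule i A r).
Proof.
move=> hA; case: r => [j|//] /=.
case: ifP => // /norP[ji jA]; case: ifP => // _.
have [iA cA] := hA; split.
  by rewrite !inE eq_sym (negbTE ji) (negbTE iA) andbF.
have A0 : (0 < #|A|)%N by rewrite cA card_peers.
have [rA _] := hrule i A j A0.
by rewrite cardsU1 !inE (negbTE jA) andbF -cA [RHS](cardsD1 (rule i A j)) rA.
Qed.

(* An evicted node is at maximal, hence positive, distance. *)
Lemma update_keeps_peer i A r j : admissible_at i A -> j \in peers i ->
  j \in A -> j \in update U rule i A r.
Proof.
move=> hA; rewrite inE => /andP[ji /eqP Uj] jA; case: r => [k|//] /=.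
case: ifP => // _; case: ifP => // _.
have A0 : (0 < #|A|)%N by apply/card_gt0P; exists j.
have [_ dr] := hrule i A k A0.
rewrite !inE jA andbT; apply/orP; right; apply/eqP => jr.
by have := maxdist_gt0 hA; rewrite -dr -jr /udist Uj subnn.
Qed.

(** A peer lies at distance 0 and has equal utility, so it passes both acceptance tests whatever the
    view. *)
Lemma update_draws_peer i A j : j \in peers i ->
  j \in update U rule i A (Some j).
Proof.
rewrite inE => /andP[ji /eqP Uj] /=.
rewrite (negbTE ji) /=; case: ifP => // _.
by rewrite Uj leqnn /udist Uj subnn /= !inE eqxx.
Qed.

Lemma update_new i A r j : j \in update U rule i A r -> j \in A \/ r = Some j.
Proof.
case: r => [k|] /=; last by left.
case: ifP => [_|_]; first by left.
case: ifP => [_|_]; last by left.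
by rewrite !inE => /orP[/eqP ->|/andP[_ jA]]; [right|left].
Qed.

Variables (V0 : views N) (y : nat -> 'I_N -> option 'I_N).
Hypothesis hV0 : admissible U V0.

Local Notation V t := (run U rule V0 y t).

Lemma run_admissible t i : admissible_at i (V t i).
Proof. by elim: t => [|t IH] /=; [exact: hV0|exact: update_admissible]. Qed.

Lemma run_drawn_peer i j s t : j \in peers i -> y s i = Some j -> (s < t)%N ->
  j \in V t i.
Proof.
move=> pj ys; elim: t => // t IH; rewrite ltnS leq_eqVlt => /orP[/eqP <-|/IH h] /=.
  by rewrite ys update_draws_peer.
by apply: update_keeps_peer => //; exact: run_admissible.
Qed.

Lemma run_undrawn i j t : j \notin V0 i -> (forall s, y s i <> Some j) ->
  j \notin V t i.
Proof.
move=> jV ys; elim: t => // t IH /=.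
by apply/negP => /update_new [|/ys //]; exact/negP.
Qed.

End SimilarViews.

(** * Probability that a given node is never drawn *)

Section UndrawnNodes.
Set Implicit Arguments.
Context {R : realType} {d : measure_display} {Omega : measurableType d}.
Variables (P : probability Omega R) (N : nat) (p : nat -> R).
Variable Y : nat -> 'I_N -> Omega -> option 'I_N.
Hypothesis hY : random_views P p Y.

Definition undrawn (i j : 'I_N) (T : nat) : set Omega :=
  [set w | forall t, (t < T)%N -> Y t i w <> Some j].

Definition never_drawn (i j : 'I_N) : set Omega :=
  [set w | forall t, Y t i w <> Some j].

(** Puts the event in the form that [independent_family] expects: a finite intersection indexed by
    pairs of a time and a node. *)
Lemma undrawnE i j T : undrawn i j T =
  \bigcap_(k in [set` [seq (t, i) | t <- iota 0 T]])
    (Y k.1 k.2 @^-1` ~` [set Some j]).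
Proof.
apply/seteqP; split => w /= h.
  by move=> _ /mapP[t + ->]; rewrite mem_iota add0n => /h.
by move=> t tT; apply: (h (t, i)); apply: map_f; rewrite mem_iota add0n.
Qed.

Lemma never_drawnE i j : never_drawn i j = \bigcap_T undrawn i j T.
Proof.
apply/seteqP; split => w /= h; first by move=> T _ t _; exact: h.
by move=> t; exact: (h t.+1 I t (leqnn _)).
Qed.

Lemma measurable_undrawn i j T : measurable (undrawn i j T).
Proof.
have [mY _ _ _] := hY; rewrite undrawnE.
by apply: fin_bigcap_measurable => // k _; exact: mY.
Qed.

Lemma measurable_never_drawn i j : measurable (never_drawn i j).
Proof.
by rewrite never_drawnE; apply: bigcapT_measurable => T; exact: measurable_undrawn.
Qed.

Lemma undrawn_prob i j T :
  P (undrawn i j T) = (\prod_(0 <= t < T) (1 - p t))%:E.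
Proof.
have [mY pY _ iY] := hY; rewrite undrawnE.
rewrite (iY _ (fun=> ~` [set Some j])).
  rewrite big_map /index_iota subn0 -prodEFin; apply: eq_bigr => t _ /=.
  by rewrite -preimage_setC probability_setC// pY.
by rewrite map_inj_uniq ?iota_uniq // => s t [].
Qed.

(** Continuity from above along the decreasing events [undrawn i j T]. *)
Lemma never_drawn_prob_cvg i j :
  (P \o undrawn i j) T @[T --> \oo] --> P (never_drawn i j).
Proof.
rewrite never_drawnE; apply: nonincreasing_cvg_mu.
- apply: le_lt_trans (ltry 1); apply: probability_le1.
  exact: measurable_undrawn.
- exact: measurable_undrawn.
- by rewrite -never_drawnE; exact: measurable_never_drawn.
- move=> S T ST; apply/subsetPset => w h t tS; apply: h.
  exact: leq_trans ST.
Qed.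

Lemma never_drawn_null i j : (forall t, 0 <= p t <= 1) ->
  (\sum_(0 <= t < T.+1) p t) @[T --> \oo] --> +oo ->
  P (never_drawn i j) = 0%E.
Proof.
move=> p01 /cvgryPge sp; apply/eqP; rewrite eq_le measure_ge0 andbT.
apply/lee_addgt0Pr => e e0; rewrite add0e.
(* With S the partial sum of [p], S >= 1/e gives exp(-S) <= 1/(1 + S) <= e. *)
have [T _ /(_ T (leqnn _)) /= hT] := sp e^-1.
apply: (@le_trans _ _ (P (undrawn i j T.+1))).
  apply: le_measure; rewrite ?inE.
  - exact: measurable_never_drawn.
  - exact: measurable_undrawn.
  - by move=> w h t _; exact: h.
rewrite undrawn_prob lee_fin.
apply: (@le_trans _ _ (\prod_(0 <= t < T.+1) expR (- p t))).
  apply: ler_prod => t _; have /andP[_ p1] := p01 t.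
  by rewrite subr_ge0 p1 /=; exact: expR_ge1Dx.
rewrite -expR_sum sumrN expRN -[leRHS]invrK lef_pV2 ?posrE ?expR_gt0 ?invr_gt0//.
apply: (le_trans hT); apply: le_trans (expR_ge1Dx _).
by rewrite lerDr.
Qed.

(** Follows from exp(2x) >= 1 + 2x and (1 + 2x)(1 - x) = 1 + x(1 - 2x) >= 1, the last bound using x
    <= 1/2. *)
Lemma expRN2_le (x : R) : 0 <= x <= 2^-1 -> expR (- (2 * x)) <= 1 - x.
Proof.
move=> /andP[x0 x2]; rewrite expRN.
have x1 : 0 < 1 - x by rewrite subr_gt0; apply: le_lt_trans x2 _; rewrite invf_lt1 ?ltr1n.
rewrite -[leRHS]invrK lef_pV2 ?posrE ?expR_gt0 ?invr_gt0//.
apply: le_trans (expR_ge1Dx _).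
rewrite -[leLHS]mul1r ler_pdivrMr//.
rewrite -subr_ge0 (_ : _ - _ = x * (1 - 2 * x)); last by ring.
by rewrite mulr_ge0 // subr_ge0 -ler_pdivlMl // mulr1.
Qed.

(** The bound exp(-2M) holds for every [undrawn i j T], uniformly in [T], and so passes to the
    limit. *)
Lemma never_drawn_pos i j M : (forall t, 0 <= p t <= 2^-1) ->
  (forall T, \sum_(0 <= t < T) p t <= M) ->
  (0 < P (never_drawn i j))%E.
Proof.
move=> p02 hM; apply: (@lt_le_trans _ _ (expR (- (2 * M)))%:E).
  by rewrite lte_fin expR_gt0.
have c := never_drawn_prob_cvg i j.
rewrite -(cvg_lim _ c)//; apply: lime_ge; first by apply/cvg_ex; eexists; exact: c.
apply: nearW => T /=; rewrite undrawn_prob lee_fin.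
apply: (@le_trans _ _ (\prod_(0 <= t < T) expR (- (2 * p t)))).
  by rewrite -expR_sum ler_expR sumrN -mulr_sumr lerN2 ler_pM2l.
by apply: ler_prod => t _; rewrite expR_ge0 expRN2_le.
Qed.

End UndrawnNodes.

(** If all initial counts equal 1, every view already holds all its peers and keeps them, so
    convergence holds whatever [p] is; hence the equivalence is stated for initial graphs where some
    count differs from 1. *)
Theorem corollary4p1 (R : realType) (d : measure_display)
    (Omega : measurableType d) (P : probability Omega R)
    (N n : nat) (U : 'I_N -> nat) (p : nat -> R)
    (rule : 'I_N -> {set 'I_N} -> 'I_N -> 'I_N)
    (Y : nat -> 'I_N -> Omega -> option 'I_N) (V0 : views N)
    (hU : forall i, (1 <= U i <= n)%N)
    (hm : forall i, (mult U (U i) <= N - 1)%N)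
    (hp : forall t, 0 < N%:R * p t < 1)
    (hrule : eviction_rule U rule)
    (hY : random_views P p Y)
    (hV0 : admissible U V0) :
  ((exists i, dissimilar U V0 i <> 1%N) ->
    (converges_to_gradient P U rule V0 Y <->
     (\sum_(0 <= t < T.+1) p t) @[T --> \oo] --> +oo))
  /\
  ((\sum_(0 <= t < T.+1) p t) @[T --> \oo] --> +oo ->
    converges_to_gradient P U rule V0 Y).
Proof.
(* The node [i] gives access to [hm]: it counts itself in [mult], so 1 <= N - 1. *)
have p02 (i : 'I_N) t : 0 <= p t <= 2^-1.
  have N2 : (2 <= N)%N.
    by rewrite -subn_gt0; apply: leq_trans (hm i); rewrite card_peers.
  have N0 : 0 < N%:R :> R by rewrite ltr0n (ltn_trans _ N2).
  have /andP[p0 p1] := hp t.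
  have p0' : 0 < p t by rewrite -(pmulr_rgt0 _ N0).
  rewrite (ltW p0') /= -[leRHS]mulr1 ler_pdivlMl//.
  by apply: le_trans (ltW p1); rewrite ler_pM2r // ler_nat.
have p01 (i : 'I_N) t : 0 <= p t <= 1.
  have /andP[-> /le_trans ->//] := p02 i t.
  by rewrite invf_le1 ?ler1n.
have sufficiency : (\sum_(0 <= t < T.+1) p t) @[T --> \oo] --> +oo ->
    converges_to_gradient P U rule V0 Y.
  move=> sp; rewrite /converges_to_gradient.
  have : {ae P, forall w, forall i j : 'I_N, ~ never_drawn Y i j w}.
    apply: filter_forall => i; apply: filter_forall => j.
    exists (never_drawn Y i j); split.
    - exact: (measurable_never_drawn hY).
    - exact: (never_drawn_null hY i j (p01 i) sp).
    - by move=> w /= /contrapT.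
  apply: filterS => w hw i.
  have /choice [s hs] : forall j, exists s, Y s i w = Some j.
    by move=> j; have /existsNP [s /contrapT hs] := hw i j; exists s.
  (* After the last of the chosen drawing times all peers are present and the count is constantly 1;
     the successor appears because a draw at time s shows in the view at s + 1. *)
  apply: cvg_near_cst; exists (\max_j (s j)).+1 => // t /= st.
  apply/eqP; rewrite pnatr_eq1 dissimilar_eq1; last exact: run_admissible.
  apply/fintype.subsetP => j pj.
  apply: (run_drawn_peer hrule (fun s k => Y s k w) hV0 (s j) t pj (hs j)).
  by apply: leq_trans st; rewrite ltnS leq_bigmax.
split => // -[i /eqP Vi]; split => // conv.
apply/cvgryPge => A; apply: contrapT => nA.
(* Partial sums are nondecreasing, so one of them exceeding [A] would keep all later ones above
   [A]. *)
have hM T : \sum_(0 <= t < T) p t <= A.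
  rewrite leNgt; apply/negP => AT; apply: nA; exists T => // S /= TS.
  apply: (le_trans (ltW AT)).
  rewrite (big_cat_nat (leq0n T) (leqW TS)) /= lerDl sumr_ge0 // => t _.
  by have /andP[] := p02 i t.
move: Vi; rewrite dissimilar_eq1; last exact: hV0.
move=> /subsetPn[j pj jV].
have := never_drawn_pos hY i j _ (p02 i) hM.
(* Where the missing peer [j] is never drawn, the count of [i] stays at least 2, at distance at
   least 1 from the limit; almost sure convergence thus makes this event null. *)
rewrite (_ : P _ = 0%E) ?ltxx //.
apply: measure_negligible; first exact: (measurable_never_drawn hY).
apply: negligibleS conv => w hw /= /(_ i) /cvgrPdist_lt /(_ 1 ltr01) [T _].
move=> /(_ T (leqnn _)) /=.
have : j \notin run U rule V0 (fun s k => Y s k w) T i.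
  exact: run_undrawn.
have := run_admissible hrule (fun s k => Y s k w) hV0 T i.
set V := run _ _ _ _ _ => hV; rewrite distrC => jVT.
have : (1 < dissimilar U V i)%N.
  rewrite ltn_neqAle dissimilar_gt0 // andbT eq_sym dissimilar_eq1 //.
  by apply/fintype.subsetPn; exists j.
rewrite -(ler_nat R) => D2; rewrite ger0_norm ?subr_ge0.
  by rewrite ltrBlDr -[1 + 1]/(2%:R) ltNge D2.
by apply: le_trans D2; rewrite ler1n.
Qed.
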